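(* Let $d,m\ge1$ be integers, let $A_1,\dots,A_d\in\mathbb{R}^{m\times m}$ be constant matrices, and let $A_0\in\mathbb{R}^{m\times m}$ be a constant symmetric positive-definite matrix such that $A_0A_j$ is symmetric for every $j=1,\dots,d$. Let $\bar\alpha_j:=\max_{1\le r\le m}|\lambda^{(r)}(A_j)|$, where $\lambda^{(1)}(A_j),\dots,\lambda^{(m)}(A_j)$ are the eigenvalues of $A_j$. Let $\delta_x>0$, let $\mathrm{CFL}>0$, and let the time step be $\delta_t=\mathrm{CFL}\,\dfrac{\delta_x}{\sum_{j=1}^d\bar\alpha_j}$. Suppose that $\mathrm{CFL}<1$ and $\alpha_j=\bar\alpha_j+\epsilon$ for $j=1,\dots,d$, with $$0<\epsilon<\frac1d\left(\frac1{\mathrm{CFL}}-1\right)\sum_{j=1}^d\bar\alpha_j .$$ Let $\bm f=(\bm f_0,\bm f_1,\dots,\bm f_{2d})$ be a solution, under periodic boundary conditions, of the source-free lattice Boltzmann method $$\bm f_k(\bm x_i+\bm e_k\delta_x,t_{n+1})=\bm f_k(\bm x_i,t_n)-\omega(\bm x_i,t_n)\left[\bm f_k(\bm x_i,t_n)-\bm f_k^{(eq)}(\bm x_i,t_n)\right],\qquad k=0,1,\dots,2d,$$ with the Lax--Friedrichs-type equilibria $\bm f_k^{(eq)}$ and the adaptive relaxation parameter $\omega(\bm x_i,t_n)$ defined in the context. Then for every $n$ $$\|\bm f(t_{n+1})\|_P\le\|\bm f(t_n)\|_P,$$ where $\|\cdot\|_P$ is the weighted $L^2$-norm defined in the context.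
   Context: The scheme approximates the linear hyperbolic system $\partial_tU+\sum_{j=1}^d A_j\partial_{x_j}U=0$ with $U\in\mathbb{R}^m$. The $\bm x_i$ are the finitely many nodes of a uniform Cartesian grid of spacing $\delta_x$ in a $d$-dimensional periodic box $\Omega$ (shifts of nodes are understood modulo periodicity), $t_{n+1}=t_n+\delta_t$, $\lambda:=\delta_x/\delta_t$, $\bm f_k(\bm x_i,t_n)\in\mathbb{R}^m$, and $U(\bm x_i,t_n):=\sum_{k=0}^{2d}\bm f_k(\bm x_i,t_n)$. Lattice (D$d$Q$(2d+1)$): $\bm e_0=0$, $\bm e_j$ is the unit vector in the $j$-th coordinate direction, and $\bm e_{j+d}=-\bm e_j$, for $j=1,\dots,d$. Lax--Friedrichs-type equilibria: for $j=1,\dots,d$, $$\bm f_0^{(eq)}=\left(1-\frac{\sum_{j=1}^d\alpha_j}{\lambda}\right)U,\qquad \bm f_j^{(eq)}=\frac{\alpha_jU+A_jU}{2\lambda},\qquad \bm f_{j+d}^{(eq)}=\frac{\alpha_jU-A_jU}{2\lambda}.$$ Thus $\bm f_k^{(eq)}=E_kU$ with $E_0=\left(1-\frac{1}{\lambda}\sum_{j=1}^d\alpha_j\right)I_m$, $E_j=\frac{1}{2\lambda}(\alpha_jI_m+A_j)$, $E_{j+d}=\frac1{2\lambda}(\alpha_jI_m-A_j)$, where $I_m$ is the $m\times m$ identity matrix. Adaptive relaxation parameter: let $A_j=R_j\Lambda_jL_j$ be a (real) eigen-decomposition with $\Lambda_j$ diagonal and $L_j=R_j^{-1}$. At time $t_n$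 and node $\bm x_i$ put $$\Delta_{j,-}W_i:=L_j\left(U(\bm x_i,t_n)-U(\bm x_i-\bm e_j\delta_x,t_n)\right),\qquad \Delta_{j,+}W_i:=L_j\left(U(\bm x_i+\bm e_j\delta_x,t_n)-U(\bm x_i,t_n)\right),$$ and, with $(\cdot)^{(r)}$ denoting the $r$-th component, $$\theta^{(r,j)}(\bm x_i)=\frac{\left|(\Delta_{j,+}W_i)^{(r)}-(\Delta_{j,-}W_i)^{(r)}\right|}{\left|(\Delta_{j,-}W_i)^{(r)}\right|+\left|(\Delta_{j,+}W_i)^{(r)}\right|+\delta_x}+\left|(\Delta_{j,-}W_i)^{(r)}\right|+\left|(\Delta_{j,+}W_i)^{(r)}\right|,$$ $$\nu(\bm x_i)=\sum_{j=1}^d\sum_{r=1}^m\theta^{(r,j)}(\bm x_i),\qquad \tilde\nu(\bm x_i)=\sum_{\bm k\in\{-1,0,1\}^d}\nu(\bm x_i+\bm k\delta_x),\qquad \omega(\bm x_i,t_n)=1+\frac1{1+\tilde\nu(\bm x_i)} .$$ Weighted norm: under the hypotheses of the theorem the matrices $A_0E_k^{-1}$ ($k=0,\dots,2d$) are well defined and symmetric positive definite, and $$\|\bm f(t_n)\|_P^2:=\sum_{\bm x_i\in\Omega}\sum_{k=0}^{2d}\bm f_k^T(\bm x_i,t_n)\,A_0E_k^{-1}\,\bm f_k(\bm x_i,t_n).$$ *)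

(* Defs.v *)
From HB Require Import structures.
From mathcomp Require Import all_boot all_order all_algebra.
From mathcomp Require Import reals.

Set Implicit Arguments.
Unset Strict Implicit.
Unset Printing Implicit Defensive.

Import Order.TTheory GRing.Theory Num.Theory.

Local Open Scope ring_scope.

Definition posdefmx (R : realType) (m : nat) (M : 'M[R]_m) : Prop :=
  M \is symmetricmx /\
  forall v : 'cV[R]_m, v != 0 -> 0 < (v^T *m M *m v) 0 0.

(* [a] is the maximum of the moduli of the (real) eigenvalues of [M].  All
   eigenvalues are real for the matrices considered, which are
   diagonalizable over R. *)
Definition is_max_abs_eigenvalue (R : realType) (m : nat) (M : 'M[R]_m)
    (a : R) : Prop :=
  (exists2 l : R, eigenvalue M l & `|l| = a) /\
  (forall l : R, eigenvalue M l -> `|l| <= a).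

Definition is_eigen_decomposition (R : realType) (m : nat)
    (M Rt Lam L : 'M[R]_m) : Prop :=
  [/\ Rt \in unitmx, L = invmx Rt, is_diag_mx Lam & M = Rt *m Lam *m L].

(* Nodes of the periodic box, by their integer coordinates: there are
   (N j).+1 nodes in direction j, so that every direction has at least one. *)
Definition node (d : nat) (N : 'I_d -> nat) : finType :=
  {dffun forall j : 'I_d, 'I_(N j).+1}.

(* The node x + k delta_x, modulo periodicity: the sum is that of Z/(N j).+1,
   whose class of 1 is [Zp1]. *)
Definition shift (d : nat) (N : 'I_d -> nat) (x : node N) (k : 'I_d -> int) :
    node N :=
  [ffun j : 'I_d => (x j + (inZp 1 : 'I_(N j).+1) *~ k j : 'I_(N j).+1)].

Definition unit_dir (d : nat) (j : 'I_d) : 'I_d -> int :=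
  fun i => (i == j)%:R.

(* The index set {0, ..., 2d} is 'I_(1 + (d + d)).  With the coordinate
   directions numbered from 1 on paper and from 0 in 'I_d, the paper's 0, j and
   j + d are [lshift (d + d) 0], [rshift 1 (lshift d j)] and
   [rshift 1 (rshift d j)]; [dir_case] is case analysis on them. *)
Definition dir_case (d : nat) (T : Type) (rest : T) (plus minus : 'I_d -> T)
    (k : 'I_(1 + (d + d))) : T :=
  match split k with
  | inl _ => rest
  | inr k' => match split k' with
              | inl j => plus j
              | inr j => minus j
              end
  end.

Definition lattice_velocity (d : nat) : 'I_(1 + (d + d)) -> 'I_d -> int :=
  dir_case (fun=> 0) (fun j => unit_dir j) (fun j => fun i => - unit_dir j i).

Definition macro (R : realType) (d m : nat) (N : 'I_d -> nat)
    (f : 'I_(1 + (d + d)) -> node N -> 'cV[R]_m) (x : node N) : 'cV[R]_m :=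
  \sum_k f k x.

Definition equilibrium (R : realType) (d m : nat) (lambda : R)
    (alpha : 'I_d -> R) (A : 'I_d -> 'M[R]_m) (U : 'cV[R]_m) :
    'I_(1 + (d + d)) -> 'cV[R]_m :=
  dir_case
    ((1 - (\sum_j alpha j) / lambda) *: U)
    (fun j => (2 * lambda)^-1 *: (alpha j *: U + A j *m U))
    (fun j => (2 * lambda)^-1 *: (alpha j *: U - A j *m U)).

Definition equilibrium_mx (R : realType) (d m : nat) (lambda : R)
    (alpha : 'I_d -> R) (A : 'I_d -> 'M[R]_m) : 'I_(1 + (d + d)) -> 'M[R]_m :=
  dir_case
    ((1 - lambda^-1 * \sum_j alpha j)%:M)
    (fun j => (2 * lambda)^-1 *: ((alpha j)%:M + A j))
    (fun j => (2 * lambda)^-1 *: ((alpha j)%:M - A j)).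

Lemma equilibriumE (R : realType) (d m : nat) (lambda : R)
    (alpha : 'I_d -> R) (A : 'I_d -> 'M[R]_m) (U : 'cV[R]_m)
    (k : 'I_(1 + (d + d))) :
  equilibrium lambda alpha A U k = equilibrium_mx lambda alpha A k *m U.
Proof.
rewrite /equilibrium /equilibrium_mx /dir_case.
case: (split k) => [_|k']; first by rewrite mul_scalar_mx mulrC.
case: (split k') => j; first by rewrite -scalemxAl mulmxDl mul_scalar_mx.
by rewrite -scalemxAl mulmxBl mul_scalar_mx.
Qed.

Definition delta_minus (R : realType) (d m : nat) (N : 'I_d -> nat)
    (L : 'I_d -> 'M[R]_m) (U : node N -> 'cV[R]_m) (j : 'I_d) (x : node N) :
    'cV[R]_m :=
  L j *m (U x - U (shift x (fun i => - unit_dir j i))).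

Definition delta_plus (R : realType) (d m : nat) (N : 'I_d -> nat)
    (L : 'I_d -> 'M[R]_m) (U : node N -> 'cV[R]_m) (j : 'I_d) (x : node N) :
    'cV[R]_m :=
  L j *m (U (shift x (unit_dir j)) - U x).

Definition theta (R : realType) (d m : nat) (N : 'I_d -> nat) (dx : R)
    (L : 'I_d -> 'M[R]_m) (U : node N -> 'cV[R]_m) (r : 'I_m) (j : 'I_d)
    (x : node N) : R :=
  let wm := delta_minus L U j x r 0 in
  let wp := delta_plus L U j x r 0 in
  `|wp - wm| / (`|wm| + `|wp| + dx) + `|wm| + `|wp|.

Definition nu (R : realType) (d m : nat) (N : 'I_d -> nat) (dx : R)
    (L : 'I_d -> 'M[R]_m) (U : node N -> 'cV[R]_m) (x : node N) : R :=
  \sum_(j < d) \sum_(r < m) theta dx L U r j x.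

(* The multi-indices of {-1, 0, 1}^d are the k - 1 for k in {0, 1, 2}^d. *)
Definition nu_tilde (R : realType) (d m : nat) (N : 'I_d -> nat) (dx : R)
    (L : 'I_d -> 'M[R]_m) (U : node N -> 'cV[R]_m) (x : node N) : R :=
  \sum_(k : {ffun 'I_d -> 'I_3})
    nu dx L U (shift x (fun j => (k j : nat)%:Z - 1)).

Definition omega (R : realType) (d m : nat) (N : 'I_d -> nat) (dx : R)
    (L : 'I_d -> 'M[R]_m) (U : node N -> 'cV[R]_m) (x : node N) : R :=
  1 + (1 + nu_tilde dx L U x)^-1.

(* [f n k x] is f_k (x, t_n). *)
Definition lbm_solution (R : realType) (d m : nat) (N : 'I_d -> nat)
    (dx lambda : R) (alpha : 'I_d -> R) (A L : 'I_d -> 'M[R]_m)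
    (f : nat -> 'I_(1 + (d + d)) -> node N -> 'cV[R]_m) : Prop :=
  forall (n : nat) (k : 'I_(1 + (d + d))) (x : node N),
    f n.+1 k (shift x (lattice_velocity k)) =
    f n k x - omega dx L (macro (f n)) x *:
                (f n k x - equilibrium lambda alpha A (macro (f n) x) k).

Definition weighted_norm (R : realType) (d m : nat) (N : 'I_d -> nat)
    (A0 : 'M[R]_m) (E : 'I_(1 + (d + d)) -> 'M[R]_m)
    (f : 'I_(1 + (d + d)) -> node N -> 'cV[R]_m) : R :=
  Num.sqrt (\sum_(x : node N) \sum_k
              ((f k x)^T *m (A0 *m invmx (E k)) *m f k x) 0 0).

(* Main.v *)
Require Import Defs.
From HB Require Import structures.
From mathcomp Require Import all_boot all_order all_algebra.
From mathcomp Require Import reals.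
From mathcomp Require Import ring lra.

Set Implicit Arguments.
Unset Strict Implicit.

Import Order.TTheory GRing.Theory Num.Theory.
Local Open Scope ring_scope.

(** The squared norm is an entropy for the scheme.  Write [P_k = A0 E_k^-1]
    and split the populations at a node as [f_k = E_k U + h_k].  Since the
    [E_k] add up to the identity and [U] is the sum of the [f_k], the
    non-equilibrium parts [h_k] add up to 0.  Moreover [P_k E_k = A0] does
    not depend on [k], so in the sum over [k] of [f_k^T P_k f_k] the cross
    terms collapse to [U^T A0 (\sum_k h_k) = 0]: equilibrium and
    non-equilibrium parts are orthogonal ([energy_split]).  Collision keeps
    [U] and multiplies every [h_k] by [1 - omega], which lies between -1 and 0
    because [nu_tilde] is nonnegative, so it can only lower the local energy,
    provided that the [P_k] are positive semidefinite
    ([collision_dissipates]).  Streaming then merely permutes the nodes,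
    separately for each [k] ([shift_inj]).

    The semidefiniteness of [P_k] is where the CFL condition enters.  Each
    [E_k] is [R D R^-1] with [D] diagonal and positive: the entries of [D] are
    positive multiples of [alpha j +- l] for eigenvalues [l] of [A j], or, for
    [k = 0], the number [1 - (\sum_j alpha j) / lambda], positive by the upper
    bound on [eps].  The symmetry of [A0 E_k] says that [G = R^T A0 R]
    commutes with [D]; then [G] also commutes with every function of [D], in
    particular with a square root of its inverse, which exhibits [A0 E_k^-1]
    as a matrix congruent to [A0] ([quad_diagonalized_ge0]). *)

(** * Symmetrizable matrices with nonnegative spectrum *)

Definition quad (R : realType) (m : nat) (M : 'M[R]_m) (v : 'cV[R]_m) : R :=
  (v^T *m M *m v) 0 0.

Definition diagonalized (R : realType) (m : nat) (Rt : 'M[R]_m)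
    (s : 'rV[R]_m) : 'M[R]_m :=
  Rt *m diag_mx s *m invmx Rt.

Lemma symmetricmx_tr (R : realType) (m : nat) (M : 'M[R]_m) :
  (M \is symmetricmx) = (M^T == M).
Proof. by rewrite is_hermitianmxE expr0 scale1r map_mx_id // eq_sym. Qed.

Lemma posdef_quad_ge0 (R : realType) (m : nat) (M : 'M[R]_m) (v : 'cV[R]_m) :
  posdefmx M -> 0 <= quad M v.
Proof.
case=> _ M_pos; have [->|v_neq0] := eqVneq v 0.
  by rewrite /quad mulmx0 mxE.
exact/ltW/M_pos.
Qed.

(** Commuting with a diagonal matrix means that the entry [(i, j)] vanishes
    unless the [i]-th and [j]-th diagonal coefficients agree, and then their
    images under [h] agree too. *)
Lemma comm_diag_map (R : realType) (m : nat) (G : 'M[R]_m) (s : 'rV[R]_m)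
    (h : R -> R) :
  G *m diag_mx s = diag_mx s *m G ->
  G *m diag_mx (map_mx h s) = diag_mx (map_mx h s) *m G.
Proof.
move=> Gs; apply/matrixP => i j.
have := congr1 (fun M : 'M[R]_m => M i j) Gs.
rewrite !mul_mx_diag !mul_diag_mx !mxE.
have [-> _|s_neq] := eqVneq (s 0 i) (s 0 j); first exact: mulrC.
move/eqP; rewrite mulrC -subr_eq0 -mulrBl mulf_eq0 subr_eq0 eq_sym.
by rewrite (negPf s_neq) => /eqP->; rewrite mulr0 mul0r.
Qed.

(** With [G = Rt^T A0 Rt] and [S] the square root of [diag_mx s], the form is
    [y^T G S^2 y = (S y)^T G (S y)] at [v = Rt y]. *)
Lemma quad_diagonalized_ge0 (R : realType) (m : nat) (A0 Rt : 'M[R]_m)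
    (s : 'rV[R]_m) (v : 'cV[R]_m) :
  posdefmx A0 -> Rt \in unitmx -> (forall i, 0 <= s 0 i) ->
  A0 *m diagonalized Rt s \is symmetricmx ->
  0 <= quad (A0 *m diagonalized Rt s) v.
Proof.
move=> A0_pos Rt_unit s_ge0; rewrite symmetricmx_tr => /eqP A0M_sym.
have /eqP A0_sym : A0^T == A0 by rewrite -symmetricmx_tr; case: A0_pos.
pose G := Rt^T *m A0 *m Rt.
have Gs : G *m diag_mx s = diag_mx s *m G.
  have -> : G *m diag_mx s = Rt^T *m (A0 *m diagonalized Rt s) *m Rt.
    by rewrite /G /diagonalized !mulmxA mulmxKV.
  rewrite -A0M_sym /diagonalized !trmx_mul A0_sym tr_diag_mx trmx_inv.
  by rewrite /G !mulmxA mulmxV ?unitmx_tr // mul1mx.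
pose S := diag_mx (map_mx Num.sqrt s).
have SS : S *m S = diag_mx s.
  rewrite mulmx_diag; congr diag_mx; apply/rowP => i.
  by rewrite !mxE -expr2 sqr_sqrtr.
have GS : G *m S = S *m G by exact: comm_diag_map.
have [y ->] : exists y, v = Rt *m y.
  by exists (invmx Rt *m v); rewrite mulKVmx.
suff -> : quad (A0 *m diagonalized Rt s) (Rt *m y) = quad A0 (Rt *m (S *m y)).
  exact: posdef_quad_ge0.
rewrite /quad; congr (fun_of_matrix _ 0 0).
transitivity (y^T *m (G *m S) *m (S *m y)); last first.
  by rewrite GS /G !trmx_mul (tr_diag_mx (map_mx _ _)) !mulmxA.
by rewrite /G /diagonalized -SS trmx_mul !mulmxA mulmxKV.
Qed.

Lemma invmx_diagonalized (R : realType) (m : nat) (Rt : 'M[R]_m)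
    (s : 'rV[R]_m) :
  Rt \in unitmx -> (forall i, 0 < s 0 i) ->
  diagonalized Rt s \in unitmx /\
  invmx (diagonalized Rt s) = diagonalized Rt (map_mx (@GRing.inv R) s).
Proof.
move=> Rt_unit s_gt0.
have inv_r : diagonalized Rt s *m diagonalized Rt (map_mx (@GRing.inv R) s)
             = 1%:M.
  rewrite /diagonalized !mulmxA mulmxKV // -(mulmxA Rt) mulmx_diag.
  have -> : \row_j (s 0 j * map_mx (@GRing.inv R) s 0 j) = const_mx 1.
    by apply/rowP => i; rewrite !mxE mulfV ?gt_eqF.
  by rewrite diag_const_mx mulmx1 mulmxV.
have [M_unit _] := mulmx1_unit inv_r; split=> //.
by rewrite -[LHS]mulmx1 -inv_r mulKmx.
Qed.

Lemma symmetric_mul_invmx (R : realType) (m : nat) (A0 M : 'M[R]_m) :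
  A0 \is symmetricmx -> M \in unitmx -> A0 *m M \is symmetricmx ->
  A0 *m invmx M \is symmetricmx.
Proof.
rewrite !symmetricmx_tr !trmx_mul => /eqP -> M_unit /eqP A0M.
rewrite trmx_inv -[X in X == _](mulmxK M_unit) -(mulmxA _ A0 M).
by rewrite -A0M mulKmx ?unitmx_tr.
Qed.

(** * Dissipation of energy by collision *)

(** Since [P k *m E k = A0] for all [k], the cross terms add up to
    [2 c U^T A0 (\sum_k h k) = 0], and the equilibrium terms to [U^T A0 U]
    because the [E k] add up to the identity. *)
Lemma energy_split (R : realType) (m : nat) (I : finType) (A0 : 'M[R]_m)
    (E P : I -> 'M[R]_m) (U : 'cV[R]_m) (h : I -> 'cV[R]_m) (c : R) :
  (forall k, (P k)^T = P k) -> (forall k, P k *m E k = A0) -> A0^T = A0 ->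
  \sum_k E k = 1%:M -> \sum_k h k = 0 ->
  \sum_k quad (P k) (E k *m U + c *: h k) =
  quad A0 U + c ^+ 2 * \sum_k quad (P k) (h k).
Proof.
move=> P_sym PE A0_sym sumE sumh.
have EP k : (E k)^T *m P k = A0 by rewrite -P_sym -trmx_mul PE.
have expand k : quad (P k) (E k *m U + c *: h k) =
    (U^T *m A0 *m (E k *m U)) 0 0 + c * (U^T *m A0 *m h k) 0 0
    + (c * ((h k)^T *m A0 *m U) 0 0 + c ^+ 2 * quad (P k) (h k)).
  have -> : quad (P k) (E k *m U + c *: h k) =
      ((U^T *m (E k)^T + c *: (h k)^T) *m P k *m (E k *m U + c *: h k)) 0 0.
    by rewrite /quad -trmx_mul -linearZ -linearD.
  rewrite /quad !mulmxDl !mulmxDr.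
  rewrite -(mulmxA U^T (E k)^T) EP -!scalemxAl -!scalemxAr.
  rewrite (mulmxA ((h k)^T *m P k)) -(mulmxA (h k)^T (P k) (E k)) PE.
  by rewrite !mxE expr2 mulrA.
rewrite (eq_bigr _ (fun k _ => expand k)) !big_split /= -!mulr_sumr.
have -> : \sum_k (U^T *m A0 *m (E k *m U)) 0 0 = quad A0 U.
  by rewrite -summxE -mulmx_sumr -mulmx_suml sumE mul1mx.
rewrite -!summxE -mulmx_sumr sumh mulmx0 -!mulmx_suml.
by rewrite -linear_sum /= sumh trmx0 !mul0mx !mxE !mulr0 addr0 add0r.
Qed.

Lemma collision_dissipates (R : realType) (m : nat) (I : finType)
    (A0 : 'M[R]_m) (E P : I -> 'M[R]_m) (f : I -> 'cV[R]_m) (w : R) :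
  (forall k, (P k)^T = P k) -> (forall k v, 0 <= quad (P k) v) ->
  (forall k, P k *m E k = A0) -> A0^T = A0 -> \sum_k E k = 1%:M ->
  0 <= w <= 2 ->
  \sum_k quad (P k) (f k - w *: (f k - E k *m \sum_l f l)) <=
  \sum_k quad (P k) (f k).
Proof.
move=> P_sym P_ge0 PE A0_sym sumE /andP[w_ge0 w_le2].
set U := \sum_l f l; pose h k := f k - E k *m U.
have sumh : \sum_k h k = 0.
  by rewrite /h sumrB -mulmx_suml sumE mul1mx subrr.
have split_f k : f k = E k *m U + 1 *: h k.
  by rewrite scale1r /h addrCA subrr addr0.
have split_g k : f k - w *: (f k - E k *m U) = E k *m U + (1 - w) *: h k.
  by rewrite -/(h k) [in LHS]split_f scalerBl !scale1r -addrA.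
rewrite (eq_bigr _ (fun k _ => congr1 (quad (P k)) (split_g k))).
rewrite [leRHS](eq_bigr _ (fun k _ => congr1 (quad (P k)) (split_f k))).
rewrite !(energy_split _ _ P_sym PE A0_sym sumE sumh) lerD2l expr1n.
by rewrite ler_wpM2r ?sumr_ge0 //; nra.
Qed.

(** * The relaxation parameter and streaming *)

Lemma nu_tilde_ge0 (R : realType) (d m : nat) (N : 'I_d -> nat) (dx : R)
    (L : 'I_d -> 'M[R]_m) (U : node N -> 'cV[R]_m) (x : node N) :
  0 <= dx -> 0 <= nu_tilde dx L U x.
Proof.
move=> dx_ge0; do 3 (apply: sumr_ge0 => ? _).
by rewrite /theta !addr_ge0 // divr_ge0 // !addr_ge0.
Qed.

Lemma omega_bounds (R : realType) (d m : nat) (N : 'I_d -> nat) (dx : R)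
    (L : 'I_d -> 'M[R]_m) (U : node N -> 'cV[R]_m) (x : node N) :
  0 <= dx -> 0 <= omega dx L U x <= 2.
Proof.
move=> /(nu_tilde_ge0 L U x) nu_ge0; rewrite /omega; apply/andP; split.
  by rewrite addr_ge0 // invr_ge0 addr_ge0.
by rewrite -[2]/(1 + 1 : R) lerD2l invf_le1 ?lerDl // ltr_pwDl.
Qed.

Lemma shift_inj (d : nat) (N : 'I_d -> nat) (k : 'I_d -> int) :
  injective (fun x : node N => shift x k).
Proof.
move=> x y /ffunP xy; apply/ffunP => j.
by have := xy j; rewrite !ffunE => /addIr.
Qed.

(** * The equilibrium matrices *)

Lemma sum_dir_case (V : nmodType) (d : nat) (rest : V)
    (plus minus : 'I_d -> V) :
  \sum_k dir_case rest plus minus k = rest + \sum_j (plus j + minus j).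
Proof.
rewrite big_split_ord big_split_ord /= big_ord1 big_split /=.
rewrite /dir_case; congr (_ + (_ + _)).
- by rewrite (unsplitK (inl _)).
- by apply: eq_bigr => j _; rewrite (unsplitK (inr _)) (unsplitK (inl _)).
- by apply: eq_bigr => j _; rewrite (unsplitK (inr _)) (unsplitK (inr _)).
Qed.

Lemma sum_equilibrium_mx (R : realType) (d m : nat) (lambda : R)
    (alpha : 'I_d -> R) (A : 'I_d -> 'M[R]_m) :
  lambda != 0 -> \sum_k equilibrium_mx lambda alpha A k = 1%:M.
Proof.
move=> lambda_neq0; rewrite sum_dir_case.
rewrite (eq_bigr (fun j => (lambda^-1 * alpha j)%:M)) => [|j _].
  rewrite -(raddf_sum (@scalar_mx R m)) -mulr_sumr -raddfD.
  by rewrite /= subrK.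
rewrite -scalerDr addrACA subrr addr0 -raddfD /= scale_scalar_mx.
by congr _%:M; field.
Qed.

(** From [L M = Lam L], the [i]-th row of [L] is a left eigenvector of [M],
    nonzero because [L] is invertible. *)
Lemma eigen_decomposition_entry (R : realType) (m : nat)
    (M Rt Lam L : 'M[R]_m) (i : 'I_m) :
  is_eigen_decomposition M Rt Lam L -> eigenvalue M (Lam i i).
Proof.
case=> Rt_unit -> /diag_mxP[s ->] ->; apply/eigenvalueP.
exists (row i (invmx Rt)).
  rewrite -row_mul !mulmxA mulVmx // mul1mx row_mul row_diag_mx.
  by rewrite -scalemxAl -rowE !mxE eqxx.
apply/eqP => row0.
have := congr1 (row i) (mulVmx Rt_unit).
rewrite row_mul row0 mul0mx => /rowP/(_ i); rewrite !mxE eqxx => /eqP.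
by rewrite eq_sym oner_eq0.
Qed.

Lemma diagonalized_scalar_add (R : realType) (m : nat) (Rt : 'M[R]_m)
    (s : 'rV[R]_m) (a b c : R) :
  Rt \in unitmx ->
  c *: (a%:M + b *: diagonalized Rt s) =
  diagonalized Rt (\row_i (c * (a + b * s 0 i))).
Proof.
move=> Rt_unit; rewrite /diagonalized.
have -> : diag_mx (\row_i (c * (a + b * s 0 i))) =
          c *: (a%:M + b *: diag_mx s).
  apply/matrixP => i j; rewrite !mxE.
  by case: (i == j); rewrite ?mulr1n // !mulr0n mulr0 addr0 mulr0.
rewrite -scalemxAr -scalemxAl mulmxDr mulmxDl mul_mx_scalar -scalemxAl.
by rewrite mulmxV // scalemx1 -scalemxAr -scalemxAl.
Qed.

Lemma equilibrium_mx_case (R : realType) (d m : nat) (lambda : R)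
    (alpha : 'I_d -> R) (A : 'I_d -> 'M[R]_m) (k : 'I_(1 + (d + d)))
    (Q : 'M[R]_m -> Prop) :
  Q (1 - lambda^-1 * \sum_j alpha j)%:M ->
  (forall j b, `|b| = 1 ->
     Q ((2 * lambda)^-1 *: ((alpha j)%:M + b *: A j))) ->
  Q (equilibrium_mx lambda alpha A k).
Proof.
move=> Q_rest Q_move; rewrite /equilibrium_mx /dir_case.
case: (split k) => // k'; case: (split k') => j.
  by have := Q_move j 1; rewrite scale1r; apply; rewrite normr1.
by have := Q_move j (-1); rewrite scaleN1r; apply; rewrite normrN1.
Qed.

(** The eigenvalues of [E_k] are positive: those of the moving directions
    because [alpha j] strictly dominates the spectrum of [A j], and that of the
    rest direction because of the CFL condition [\sum_j alpha j < lambda]. *)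
Lemma equilibrium_mx_diagonalized (R : realType) (d m : nat) (lambda : R)
    (alpha abar : 'I_d -> R) (A Rt Lam L : 'I_d -> 'M[R]_m)
    (k : 'I_(1 + (d + d))) :
  (forall j, is_eigen_decomposition (A j) (Rt j) (Lam j) (L j)) ->
  (forall j, is_max_abs_eigenvalue (A j) (abar j)) ->
  (forall j, abar j < alpha j) -> 0 < lambda -> \sum_j alpha j < lambda ->
  exists2 Rk : 'M[R]_m, Rk \in unitmx &
    exists2 s : 'rV[R]_m, (forall i, 0 < s 0 i) &
      equilibrium_mx lambda alpha A k = diagonalized Rk s.
Proof.
move=> Adec abarP alpha_gt lambda_gt0 sum_alpha.
elim/equilibrium_mx_case: (equilibrium_mx lambda alpha A k) => [|j b b1].
  exists 1%:M; first exact: unitmx1.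
  exists (const_mx (1 - lambda^-1 * \sum_j alpha j)) => [i|].
    by rewrite mxE subr_gt0 mulrC ltr_pdivrMr // mul1r.
  by rewrite /diagonalized diag_const_mx mul1mx invmx1 mulmx1.
have [Rt_unit L_inv /diag_mxP[s Lam_s] A_eq] := Adec j.
exists (Rt j) => //; exists (\row_i ((2 * lambda)^-1 * (alpha j + b * s 0 i))).
  move=> i; rewrite mxE mulr_gt0 // ?invr_gt0 ?mulr_gt0 //.
  have [_ abar_max] := abarP j.
  have := abar_max _ (eigen_decomposition_entry i (Adec j)).
  rewrite Lam_s mxE eqxx mulr1n -[`|_|]mul1r -b1 -normrM.
  by rewrite ler_norml => /andP[le_bs _]; have := alpha_gt j; lra.
by rewrite -diagonalized_scalar_add // A_eq L_inv Lam_s.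
Qed.

Lemma symmetric_mul_equilibrium_mx (R : realType) (d m : nat) (lambda : R)
    (alpha : 'I_d -> R) (A : 'I_d -> 'M[R]_m) (A0 : 'M[R]_m)
    (k : 'I_(1 + (d + d))) :
  A0 \is symmetricmx -> (forall j, A0 *m A j \is symmetricmx) ->
  A0 *m equilibrium_mx lambda alpha A k \is symmetricmx.
Proof.
move=> A0_sym A0A_sym; move: A0_sym; rewrite symmetricmx_tr => /eqP A0_sym.
elim/equilibrium_mx_case: (equilibrium_mx lambda alpha A k) => [|j b _].
  by rewrite symmetricmx_tr mul_mx_scalar linearZ /= A0_sym.
move: (A0A_sym j); rewrite !symmetricmx_tr => /eqP A0A.
rewrite -scalemxAr mulmxDr mul_mx_scalar -scalemxAr.
by rewrite linearZ linearD !linearZ /= A0A A0_sym.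
Qed.

Unset Implicit Arguments.
Set Strict Implicit.

(** * Decay of the weighted norm *)

Theorem theorem4p3 (R : realType) (d m : nat) (hd : (1 <= d)%N)
    (hm : (1 <= m)%N) (N : 'I_d -> nat)
    (A : 'I_d -> 'M[R]_m) (A0 : 'M[R]_m)
    (hA0 : posdefmx A0)
    (hA0A : forall j : 'I_d, A0 *m A j \is symmetricmx)
    (Rt Lam L : 'I_d -> 'M[R]_m)
    (hdec : forall j : 'I_d,
       is_eigen_decomposition (A j) (Rt j) (Lam j) (L j))
    (abar : 'I_d -> R)
    (habar : forall j : 'I_d, is_max_abs_eigenvalue (A j) (abar j))
    (dx dt lambda CFL eps : R) (alpha : 'I_d -> R)
    (hdx : 0 < dx) (hCFL0 : 0 < CFL)
    (hdt : dt = CFL * (dx / \sum_(j < d) abar j))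
    (hlambda : lambda = dx / dt)
    (hCFL1 : CFL < 1)
    (halpha : forall j : 'I_d, alpha j = abar j + eps)
    (heps0 : 0 < eps)
    (heps1 : eps < d%:R^-1 * (CFL^-1 - 1) * \sum_(j < d) abar j)
    (f : nat -> 'I_(1 + (d + d)) -> node N -> 'cV[R]_m)
    (hf : lbm_solution dx lambda alpha A L f) (n : nat) :
  weighted_norm A0 (equilibrium_mx lambda alpha A) (f n.+1) <=
  weighted_norm A0 (equilibrium_mx lambda alpha A) (f n).
Proof.
set E := equilibrium_mx lambda alpha A.
have A0_sym : A0 \is symmetricmx by case: hA0.
have d_gt0 : 0 < d%:R :> R by rewrite ltr0n.
have abar_ge0 j : 0 <= abar j by case: (habar j) => [[l _ <-] _].
have sum_gt0 : 0 < \sum_j abar j.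
  rewrite lt_neqAle sumr_ge0 // andbT; apply: contraTneq heps1 => <-.
  by rewrite mulr0 -leNgt ltW.
have lambdaE : lambda = (\sum_j abar j) / CFL.
  by rewrite hlambda hdt; field; rewrite !gt_eqF.
have lambda_gt0 : 0 < lambda by rewrite lambdaE divr_gt0.
have sum_alpha : \sum_j alpha j < lambda.
  rewrite (eq_bigr _ (fun j _ => halpha j)) big_split /= sumr_const card_ord.
  rewrite -mulr_natl lambdaE -ltrBrDl.
  have -> : (\sum_j abar j) / CFL - \sum_j abar j =
            d%:R * (d%:R^-1 * (CFL^-1 - 1) * \sum_j abar j).
    by field; rewrite !gt_eqF.
  by rewrite ltr_pM2l.
have A0E_sym k : A0 *m E k \is symmetricmx.
  exact: symmetric_mul_equilibrium_mx.
have alpha_gt j : abar j < alpha j by rewrite halpha ltrDl.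
have E_diag k := equilibrium_mx_diagonalized k hdec habar alpha_gt
                   lambda_gt0 sum_alpha.
have E_unit k : E k \in unitmx.
  have [Rk Rk_unit [s s_gt0 Ek]] := E_diag k.
  by rewrite /E Ek; case: (invmx_diagonalized Rk_unit s_gt0).
have P_sym k : A0 *m invmx (E k) \is symmetricmx.
  exact: symmetric_mul_invmx.
have P_ge0 k v : 0 <= quad (A0 *m invmx (E k)) v.
  have [Rk Rk_unit [s s_gt0 Ek]] := E_diag k.
  have [_ inv_Ek] := invmx_diagonalized Rk_unit s_gt0.
  have := P_sym k; rewrite /E Ek inv_Ek.
  apply: quad_diagonalized_ge0 => // i.
  by rewrite mxE invr_ge0 ltW.
rewrite /weighted_norm ler_wsqrtr // exchange_big /=.
(* For each k, shifting by the k-th velocity permutes the nodes. *)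
rewrite (eq_bigr _ (fun k _ =>
  reindex_inj (@shift_inj d N (lattice_velocity k)))).
rewrite exchange_big /=; apply: ler_sum => x _.
under eq_bigr => k _ do rewrite hf equilibriumE.
apply: (collision_dissipates (P := fun k => A0 *m invmx (E k))).
- by move=> k; apply/eqP; rewrite -symmetricmx_tr.
- exact: P_ge0.
- by move=> k; rewrite mulmxKV.
- by apply/eqP; rewrite -symmetricmx_tr.
- by apply: sum_equilibrium_mx; rewrite gt_eqF.
- exact/omega_bounds/ltW.
Qed.
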